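(* Let $G$ and $G^*$ be graphs on the same vertex set $V=\{v_1,\dots,v_n\}$ with adjacency matrices $A$ and $A^*$, and let $S,S^*\subseteq V$ be non-empty with $W^S_G=W^{S^*}_{G^*}$. If this walk matrix has rank $n-1$, then $A=A^*$. (That is, a walk matrix of rank $|V|-1$ determines the adjacency matrix.)
   Context: Graphs are finite, simple, undirected. For a graph $G$ with vertex set $V=\{v_1,\dots,v_n\}$, adjacency matrix $A$, and non-empty $S\subseteq V$ with characteristic vector ${\rm e}\in\{0,1\}^n$, the walk matrix is $W^S_G=[{\rm e},A{\rm e},\dots,A^{n-1}{\rm e}]$. *)

(* Defs.v *)
From HB Require Import structures.
From mathcomp Require Import all_boot all_order all_algebra.

Set Implicit Arguments.
Unset Strict Implicit.
Unset Printing Implicit Defensive.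

Import GRing.Theory.
Local Open Scope ring_scope.

Record sgraph (n : nat) := SGraph {
  edge :> rel 'I_n;
  edge_sym : symmetric edge;
  edge_irrefl : irreflexive edge
}.

Definition adjacency (n : nat) (G : sgraph n) : 'M[rat]_n :=
  \matrix_(i, j) (G i j)%:R.

Definition charvec (n : nat) (S : {set 'I_n}) : 'cV[rat]_n :=
  \col_i (i \in S)%:R.

(* Column k is A^k e, for k = 0, ..., n-1. *)
Definition walk_matrix (n : nat) (G : sgraph n) (S : {set 'I_n}) : 'M[rat]_n :=
  \matrix_(i, k < n) (adjacency G ^+ k *m charvec S) i 0.

(* Main.v *)
Require Import Defs.
From HB Require Import structures.
From mathcomp Require Import all_boot all_order all_algebra.

Set Implicit Arguments.
Unset Strict Implicit.
Unset Printing Implicit Defensive.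

Import GRing.Theory.
Local Open Scope ring_scope.

(** The difference D = A - A* kills A^k e for k < n - 1, because the columns
    A^(k+1) e of the two walk matrices agree. A walk matrix of rank less than n
    has its last column in the span of the others, so D kills the whole column
    space of W, which has dimension n - 1; hence D has rank at most 1. All 2x2
    minors of D then vanish, and since D is symmetric with zero diagonal, the
    principal ones are -(D i j)^2. *)

(** Stated over any field and for an arbitrary matrix and vector; [walk_matrix G S] is convertible
    to [krylov_mx (adjacency G) (charvec S)]. *)
Definition krylov_mx (F : fieldType) (n : nat) (A : 'M[F]_n) (e : 'cV[F]_n) :
    'M[F]_n :=
  \matrix_(i, k < n) (A ^+ k *m e) i 0.

Lemma col_krylov_mx (F : fieldType) (n : nat) (A : 'M[F]_n) (e : 'cV[F]_n)
    (k : 'I_n) :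
  col k (krylov_mx A e) = A ^+ k *m e.
Proof. by apply/colP=> i; rewrite !mxE. Qed.

Lemma krylov_mx_mul (F : fieldType) (n : nat) (A : 'M[F]_n) (e c : 'cV[F]_n) :
  krylov_mx A e *m c = \sum_(k < n) c k 0 *: (A ^+ k *m e).
Proof.
apply/colP=> i; rewrite mxE summxE.
by apply: eq_bigr => k _; rewrite !mxE mulrC.
Qed.

Lemma singular_kernel_vector (F : fieldType) (n : nat) (M : 'M[F]_n) :
  (\rank M < n)%N -> exists2 c : 'cV[F]_n, c != 0 & M *m c = 0.
Proof.
move=> rkM; have /rowV0Pn[v /sub_kermxP vM v0] : kermx M^T != 0.
  by rewrite -mxrank_eq0 mxrank_ker mxrank_tr -lt0n subn_gt0.
exists v^T; first by rewrite -(inj_eq trmx_inj) trmxK trmx0.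
by apply: trmx_inj; rewrite trmx_mul trmxK vM trmx0.
Qed.

Lemma krylov_mx_annihilator (F : fieldType) (n : nat) (A D : 'M[F]_n)
    (e : 'cV[F]_n) :
  (\rank (krylov_mx A e) < n)%N ->
  (forall k, (k.+1 < n)%N -> D *m (A ^+ k *m e) = 0) ->
  D *m krylov_mx A e = 0.
Proof.
move=> /singular_kernel_vector[c /matrix0Pn[i0 [j0]]].
rewrite (ord1 j0) => {j0} ci0 Wc Dlow.
have [m cm max_m] :=
  @arg_maxnP _ i0 (fun k => c k 0 != 0) (fun k => nat_of_ord k) ci0.
have le_m : (m <= n.-1)%N by rewrite -ltnS (ltn_predK (ltn_ord m)).
(* Shift the dependency so that its top term is the last column. *)
have shift : \sum_(k < n) c k 0 *: (D *m (A ^+ (n.-1 - m + k) *m e)) = 0.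
  transitivity (D *m (A ^+ (n.-1 - m) *m (krylov_mx A e *m c))).
    rewrite krylov_mx_mul !mulmx_sumr; apply: eq_bigr => k _.
    by rewrite -!scalemxAr exprD -!mulmxA.
  by rewrite Wc !mulmx0.
have Dlast : D *m (A ^+ n.-1 *m e) = 0.
  (* Only the term [k = m] survives: coefficients above [m] vanish by maximality, and for [k < m]
     the exponent [n.-1 - m + k] is below [n.-1], so [Dlow] applies. *)
  move: shift; rewrite (bigD1 m) //= big1 ?addr0 => [|k km].
    by rewrite subnK // => /eqP; rewrite scaler_eq0 (negPf cm) => /eqP.
  have [->|ck] := eqVneq (c k 0) 0; first by rewrite scale0r.
  have lt_km : (k < m)%N by rewrite ltn_neqAle (inj_eq val_inj) km; apply: max_m.
  rewrite Dlow ?scaler0 //; apply: (@leq_ltn_trans n.-1).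
    by rewrite -ltn_subRL subKn.
  by rewrite ltn_predL (leq_ltn_trans _ (ltn_ord m)).
apply/matrixP=> i k; rewrite [RHS]mxE.
suff /colP/(_ i) : col k (D *m krylov_mx A e) = 0 by rewrite !mxE.
rewrite colE -mulmxA -colE col_krylov_mx.
have [/Dlow //|] := ltnP k.+1 n.
rewrite leq_eqVlt ltnNge ltn_ord orbF => /eqP nE.
have -> : nat_of_ord k = n.-1 by rewrite {2}nE.
exact: Dlast.
Qed.

(** A full-rank factorization writes [M] as a column times a row (or as an empty product when the
    rank is 0), so both sides are the same product of four scalars. *)
Lemma rank_le1_minor (F : fieldType) (m n : nat) (M : 'M[F]_(m, n))
    (i k : 'I_m) (j l : 'I_n) :
  (\rank M <= 1)%N -> M i j * M k l = M i l * M k j.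
Proof.
move: (col_base M) (row_base M) (mulmx_base M).
case: (\rank M) => [|[|//]] C R <- _.
  by rewrite !mxE !big_ord0 !mul0r.
by rewrite !mxE !big_ord1 mulrACA [R _ j * _]mulrC mulrACA.
Qed.

Lemma sym_diag0_rank_le1 (F : fieldType) (n : nat) (M : 'M[F]_n) :
  M^T = M -> (forall i, M i i = 0) -> (\rank M <= 1)%N -> M = 0.
Proof.
move=> symM diagM rkM; apply/matrixP=> i j; rewrite [RHS]mxE.
have := rank_le1_minor i j i j rkM; rewrite !diagM mul0r -{2}symM mxE.
by move/esym/eqP; rewrite mulf_eq0 orbb => /eqP.
Qed.

Lemma adjacency_tr (n : nat) (G : sgraph n) : (adjacency G)^T = adjacency G.
Proof. by apply/matrixP=> i j; rewrite !mxE edge_sym. Qed.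

Lemma adjacency_diag (n : nat) (G : sgraph n) (i : 'I_n) : adjacency G i i = 0.
Proof. by rewrite mxE edge_irrefl. Qed.

Theorem theorem5p5 (n : nat) (G Gstar : sgraph n) (S Sstar : {set 'I_n})
    (hS : S != set0) (hSstar : Sstar != set0)
    (hW : walk_matrix G S = walk_matrix Gstar Sstar)
    (hrank : \rank (walk_matrix G S) = (n - 1)%N) :
  adjacency G = adjacency Gstar.
Proof.
have [i0 _] := set0Pn _ hS.
(* With [n] positive, the truncated [n - 1] is really smaller than [n]. *)
have n_gt0 : (0 < n)%N by case: (n) i0 => // -[].
set A := adjacency G; set B := adjacency Gstar.
have walkE k : (k < n)%N -> A ^+ k *m charvec S = B ^+ k *m charvec Sstar.
  move=> lt_kn; have := congr1 (col (Ordinal lt_kn)) hW.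
  by rewrite [LHS]col_krylov_mx [RHS]col_krylov_mx.
have DW : (A - B) *m walk_matrix G S = 0.
  apply: krylov_mx_annihilator => [|k lt_kn].
    by rewrite -/(walk_matrix G S) hrank subn1 prednK.
  (* Replacing [A ^+ k *m charvec S] only in the [B] term turns the difference into that of the two
     walks of length [k.+1]. *)
  rewrite mulmxBl {2}walkE 1?ltnW // !mulmxA.
  by have := walkE _ lt_kn; rewrite !exprS => ->; rewrite subrr.
apply/eqP; rewrite -subr_eq0; apply/eqP/sym_diag0_rank_le1.
- by rewrite raddfB /= !adjacency_tr.
- by move=> i; rewrite mxE [X in _ + X]mxE !adjacency_diag subrr.
have := mulmx0_rank_max DW.
by rewrite hrank addnC -leq_subRL ?leq_subr // subKn.
Qed.
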